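(* Suppose that $A$ and $B$ are any pair of complementary sequences, with $n$th terms $a_n$ and $b_n$ respectively. Then: (1) The sequence of differences of $A$ and $B$, term by term, can always be decomposed in terms of the sum of two other sequences $C=(c_n)$ and $R=(r_n)$ as follows: $$b_n-a_n=c_n+r_n+1,$$ where $c_n$ counts the number of integers strictly between $a_n$ and $b_n$ that belong to the sequence $A$, and $r_n$ counts the number of integers strictly between $a_n$ and $b_n$ that belong to the sequence $B$. (2) If the two complementary sequences $A$ and $B$ are also Beatty sequences given by $\alpha$ and $\beta$ respectively (that is, $a_n=[n\alpha]$ and $b_n=[n\beta]$), with $1<\alpha<2$, then the sequences $C$ and $R$ in (1) are Beatty sequences whose $n$th terms are given respectively by the slopes $$\gamma=\frac{2-\alpha}{\alpha-1}=\frac{\beta}{\alpha}-1\qquad\text{and}\qquad \rho=2-\alpha=1-\frac{\alpha}{\beta},$$ that is, $c_n=[n\gamma]$ and $r_n=[n\rho]$.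
   Context: $\mathbb N$ denotes the natural numbers $1,2,3,\dots$ and $[x]$ the largest integer not exceeding $x$. $A$ and $B$ are complementary sets (sequences) of natural numbers if $A\cap B=\emptyset$ and $A\cup B=\mathbb N$; the elements of $A$ and of $B$ are numbered in nondecreasing order as $a_1\le a_2\le\dots$ and $b_1\le b_2\le\dots$. A Beatty sequence given by (with slope) $\beta>0$ is the sequence with $n$th term $[n\beta]$. By Beatty's theorem, the sets given by $a_n=[n\alpha]$ and $b_n=[n\beta]$ are complementary if and only if $\alpha$ is irrational and $\frac1\alpha+\frac1\beta=1$.
   Formalization: In (1) the equation is proved as |b_n − a_n| = c_n + r_n + 1 for every n, and as b_n − a_n = c_n + r_n + 1 only when a_n < b_n, since the signed form fails when a_n > b_n (A the even, B the odd numbers, n = 1). *)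

(* Defs.v *)
From HB Require Import structures.
From mathcomp Require Import all_boot all_order all_algebra.
From mathcomp Require Import all_classical all_reals.
Set Implicit Arguments.
Unset Strict Implicit.
Unset Printing Implicit Defensive.
Import Order.TTheory GRing.Theory Num.Theory.
Local Open Scope classical_set_scope.
Local Open Scope ring_scope.

(* The natural numbers 1, 2, 3, ... without 0. *)
Definition posnat : set nat := [set n | (0 < n)%N].

Definition complementary (A B : set nat) : Prop :=
  A `&` B = set0 /\ A `|` B = posnat.

(* Sequences are indexed from 1: the value [a 0] is never constrained or used.
   The order is nondecreasing rather than increasing, so repetitions are not
   excluded. *)
Definition enumerates (a : nat -> nat) (A : set nat) : Prop :=
  a @` posnat = A /\
  (forall m n : nat, (0 < m)%N -> (m <= n)%N -> (a m <= a n)%N).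

Definition beatty_seq (R : realType) (beta : R) (u : nat -> nat) : Prop :=
  0 < beta /\
  (forall n : nat, (0 < n)%N -> (u n)%:Z = Num.floor (n%:R * beta)).

(* Symmetric in [x] and [y], so that it makes sense whichever is larger. *)
Definition count_between (S : set nat) (x y : nat) : nat :=
  count (fun k => k \in S) (index_iota (minn x y).+1 (maxn x y)).

Definition between_seq (S : set nat) (a b : nat -> nat) (n : nat) : nat :=
  count_between S (a n) (b n).

(* Main.v *)
(* Any [n > 0] puts [a n] in [A] and [b n] in [B], and each of the
   [`|b n - a n| - 1] integers strictly between them lies in exactly one of [A]
   and [B]; this is (1).
   For (2), [1 <= beta] because [b 1 > 0], so neither sequence
   repeats. Counting the integers below [a n] gives [a n - n = [a n / beta]],
   and letting [n] grow forces [alpha - 1 = alpha / beta]. Disjointness makes [k alpha <= n beta]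
   equivalent to [a k < b n], so that
   [c n = [n beta / alpha] - n = b n - 2 n]. Then [r n = 2 n - 1 - a n] by (1),
   and this is [[n (2 - alpha)]] since [n alpha] is not an integer: if
   [n alpha = m] then also [m = (m - n) beta], hence [a n = b (m - n)]. *)
Require Import Defs.
From HB Require Import structures.
From mathcomp Require Import all_boot all_order all_algebra.
From mathcomp Require Import all_classical all_reals.
From mathcomp Require Import zify ring lra.
Import Order.TTheory GRing.Theory Num.Theory.
Local Open Scope ring_scope.

(** Counting elements becomes counting indices: by injectivity the list of [u k] for [i < k <= j]
    has no repetition, and it has the same members as the part of [S] in [[l, m)]. *)
Lemma count_image (S : set nat) (u : nat -> nat) (l m i j : nat) :
  (u @` posnat)%classic = S ->
  (forall k k', (0 < k)%N -> (0 < k')%N -> u k = u k' -> k = k') ->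
  (forall k, (0 < k)%N -> (l <= u k < m)%N = (i < k <= j)%N) ->
  count (fun x => x \in S) (index_iota l m) = (j - i)%N.
Proof.
move=> uS uinj ulm; rewrite -size_filter.
have -> : (j - i)%N = size (map u (index_iota i.+1 j.+1)).
  by rewrite size_map size_iota subSS.
apply/perm_size/uniq_perm.
- by rewrite filter_uniq ?iota_uniq.
- rewrite map_inj_in_uniq ?iota_uniq // => k k'; rewrite !mem_index_iota.
  by move=> /andP[ik _] /andP[ik' _]; apply: uinj; lia.
move=> x; rewrite mem_filter mem_index_iota; apply/andP/mapP.
  move=> [/set_mem]; rewrite -uS => -[k /= k0 <-].
  rewrite ulm // => /andP[ik kj]; exists k => //.
  by rewrite mem_index_iota ik.
move=> [k]; rewrite mem_index_iota ltnS => /andP[ik kj] ->.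
have k0 : (0 < k)%N by lia.
split; first by apply/mem_set; rewrite -uS; exists k.
by rewrite ulm // ik.
Qed.

Lemma complementary_count (A B : set nat) (l m : nat) :
  complementary A B -> (0 < l)%N ->
  (count (fun x => x \in A) (index_iota l m) +
   count (fun x => x \in B) (index_iota l m))%N = (m - l)%N.
Proof.
move=> [AB0 ABT] l0; rewrite -(size_iota l (m - l)).
rewrite -(count_predC (fun x => x \in A)); congr (_ + _)%N.
apply: eq_in_count => x; rewrite mem_index_iota => /andP[lx _] /=.
have ABx : (A `|` B)%classic x by rewrite ABT /posnat /=; lia.
apply/idP/idP => [/set_mem Bx | /negP nAx].
  apply/negP => /set_mem Ax.
  by have : (A `&` B)%classic x by []; rewrite AB0.
by apply/mem_set; case: ABx => // Ax; case: nAx; apply/mem_set.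
Qed.

Lemma beatty_geE (R : realType) (t : R) (u : nat -> nat) (m n : nat) :
  beatty_seq t u -> (0 < n)%N -> (m <= u n)%N = (m%:R <= n%:R * t).
Proof.
by move=> [_ ut] n0; rewrite -lez_nat ut // -[m%:Z]/(Posz m) floor_ge_int.
Qed.

Lemma beatty_ltE (R : realType) (t : R) (u : nat -> nat) (m n : nat) :
  beatty_seq t u -> (0 < n)%N -> (u n < m)%N = (n%:R * t < m%:R).
Proof. by move=> ut n0; rewrite ltnNge (beatty_geE _ _ _ _ _ ut) // ltNge. Qed.

Lemma beatty_ltn (R : realType) (t : R) (u : nat -> nat) (k k' : nat) :
  beatty_seq t u -> 1 <= t -> (0 < k)%N -> (k < k')%N -> (u k < u k')%N.
Proof.
move=> ut t1 k0 kk'; have k'0 : (0 < k')%N by lia.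
rewrite (beatty_geE _ _ _ _ _ ut) //.
have : (u k)%:R <= k%:R * t by rewrite -(beatty_geE _ _ _ _ _ ut).
have : k%:R + 1 <= k'%:R :> R by rewrite natr1 ler_nat.
rewrite -natr1; nra.
Qed.

Lemma beatty_inj (R : realType) (t : R) (u : nat -> nat) (k k' : nat) :
  beatty_seq t u -> 1 <= t -> (0 < k)%N -> (0 < k')%N -> u k = u k' -> k = k'.
Proof.
move=> ut t1 k0 k'0 e; case: (ltngtP k k') => // kk'.
- by have := beatty_ltn _ _ _ _ _ ut t1 k0 kk'; rewrite e ltnn.
- by have := beatty_ltn _ _ _ _ _ ut t1 k'0 kk'; rewrite e ltnn.
Qed.

(** Archimedean property: if [x] were nonzero, some [n] above [C / |x|] would break the bound. *)
Lemma natmul_bounded_eq0 (R : realType) (x C : R) :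
  (forall n : nat, (0 < n)%N -> `|n%:R * x| <= C) -> x = 0.
Proof.
move=> xC; apply/eqP/negP => /negP; rewrite -normr_gt0 => x0.
have C0 : 0 <= C by apply: le_trans (xC 1%N _).
set n := (Num.truncn (C / `|x|)).+1.
have := xC n isT; rewrite normrM normr_nat -ler_pdivlMr // leNgt.
by rewrite /n truncnS_gt.
Qed.

Lemma enum_mem (S : set nat) (u : nat -> nat) (n : nat) :
  enumerates u S -> (0 < n)%N -> S (u n).
Proof. by move=> [<- _] n0; exists n. Qed.

Lemma complementary_neq (A B : set nat) (a b : nat -> nat) (k n : nat) :
  complementary A B -> enumerates a A -> enumerates b B ->
  (0 < k)%N -> (0 < n)%N -> a k <> b n.
Proof.
move=> [AB0 _] ha hb k0 n0 e.
have : (A `&` B)%classic (a k).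
  by split; [exact: (enum_mem _ _ _ ha)|rewrite e; exact: (enum_mem _ _ _ hb)].
by rewrite AB0.
Qed.

Lemma complementary_gt0 (A B : set nat) (x : nat) :
  complementary A B -> A x \/ B x -> (0 < x)%N.
Proof. by move=> [_ AB]; rewrite -[_ \/ _]/((A `|` B)%classic x) AB. Qed.

Lemma complementary_diff (A B : set nat) (a b : nat -> nat) (n : nat) :
  complementary A B -> enumerates a A -> enumerates b B -> (0 < n)%N ->
  (maxn (a n) (b n) - minn (a n) (b n))%N =
  (between_seq A a b n + between_seq B a b n + 1)%N.
Proof.
(* If [a n = b n] were possible, the left side would be 0 and the right side at least 1. *)
move=> hAB ha hb n0; have ab := complementary_neq _ _ _ _ _ _ hAB ha hb n0 n0.
by rewrite /between_seq /count_between (complementary_count _ _ _ _ hAB) //; lia.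
Qed.

(** The relation [1 / alpha + 1 / beta = 1], cleared of denominators. *)
Lemma beatty_complementary (R : realType) (A B : set nat) (a b : nat -> nat)
    (alpha beta : R) :
  complementary A B -> enumerates a A -> enumerates b B ->
  beatty_seq alpha a -> beatty_seq beta b -> 1 < alpha ->
  alpha = (alpha - 1) * beta.
Proof.
move=> hAB ha hb Ha Hb alpha1.
have beta1 : 1 <= beta.
  rewrite -[beta]mul1r -(beatty_geE _ _ _ 1%N 1%N Hb) //.
  by apply: (complementary_gt0 _ _ _ hAB); right; exact: (enum_mem _ _ _ hb).
have alpha1' := ltW alpha1.
(* Of the integers in [[1, a n)], exactly [n - 1] lie in [A] and [j] in [B], where [j] is the
   integer part of [a n / beta]. *)
have below n : (0 < n)%N ->
    exists2 j, (a n = n + j)%N & j%:R * beta <= (a n)%:R < (j%:R + 1) * beta.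
  move=> n0; set j := Num.truncn ((a n)%:R / beta).
  have beta0 : 0 < beta by lra.
  have jP : j%:R * beta <= (a n)%:R < (j%:R + 1) * beta.
    rewrite natr1 -ler_pdivlMr // -ltr_pdivrMr // truncnS_gt andbT.
    by rewrite truncn_le divr_ge0 // ltW.
  exists j => //; have /andP[jle jgt] := jP.
  have an1 : (0 < a n)%N.
    by apply: (complementary_gt0 _ _ _ hAB); left; exact: (enum_mem _ _ _ ha).
  have := complementary_count _ _ 1 (a n) hAB isT.
  rewrite (count_image _ _ _ _ 0 n.-1 ha.1); last 2 first.
  - by move=> k k'; apply: beatty_inj Ha _.
  - move=> k k0.
    have -> : (0 < a k)%N.
      by apply: (complementary_gt0 _ _ _ hAB); left; exact: (enum_mem _ _ _ ha).
    rewrite k0 /=; case: (ltngtP k n) => kn.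
    + by rewrite (beatty_ltn _ _ _ _ _ Ha) //; lia.
    + by have := beatty_ltn _ _ _ _ _ Ha alpha1' n0 kn; lia.
    + by rewrite kn; lia.
  rewrite (count_image _ _ _ _ 0 j hb.1); first by lia.
    by move=> k k'; apply: beatty_inj Hb _.
  move=> k k0.
  have -> : (0 < b k)%N.
    by apply: (complementary_gt0 _ _ _ hAB); right; exact: (enum_mem _ _ _ hb).
  rewrite k0 /=; have nab := complementary_neq _ _ _ _ _ _ hAB ha hb n0 k0.
  (* If [k <= j], then [k beta <= a n], and disjointness makes [b k <= a n] strict; if [k > j], then
     [k beta > a n]. *)
  case: (leqP k j) => kj.
    have bk : (b k <= a n)%N.
      rewrite -(ler_nat R); apply: le_trans jle.
      apply: (@le_trans _ _ (k%:R * beta)).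
        by rewrite -(beatty_geE _ _ _ _ _ Hb).
      by rewrite ler_pM2r // ler_nat.
    by lia.
  rewrite (beatty_ltE _ _ _ _ _ Hb) //; apply/negbTE; rewrite -leNgt.
  apply: le_trans (ltW jgt) _.
  by rewrite ler_pM2r // natr1 ler_nat.
apply/eqP; rewrite eq_sym -subr_eq0; apply/eqP.
(* With [n alpha = a n + t] and [0 <= t < 1], the multiple is [(j beta - a n) + t (beta - 1)], which
   stays well within this bound. *)
apply: (@natmul_bounded_eq0 _ _ (1 + 2 * beta)) => n n0.
have [j anj /andP[jle jgt]] := below n n0.
have : (a n)%:R <= n%:R * alpha by rewrite -(beatty_geE _ _ _ _ _ Ha).
have : n%:R * alpha < (a n)%:R + 1.
  by rewrite natr1 -(beatty_ltE _ _ _ _ _ Ha).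
move: jle jgt; rewrite anj natrD => *.
rewrite ler_norml; apply/andP; split; nra.
Qed.

(** Stands in for the irrationality of [alpha]: equality would make [b] take the value [a n] at
    index [a n - n]. *)
Lemma beatty_complementary_lt (R : realType) (A B : set nat)
    (a b : nat -> nat) (alpha beta : R) (n : nat) :
  complementary A B -> enumerates a A -> enumerates b B ->
  beatty_seq alpha a -> beatty_seq beta b -> 1 < alpha ->
  (0 < n)%N -> (a n)%:R < n%:R * alpha.
Proof.
move=> hAB ha hb Ha Hb alpha1 n0.
have ab := beatty_complementary _ _ _ _ _ _ _ hAB ha hb Ha Hb alpha1.
have n0R : 0 < n%:R :> R by rewrite ltr0n.
have anle : (a n)%:R <= n%:R * alpha by rewrite -(beatty_geE _ _ _ _ _ Ha).
rewrite lt_neqAle anle andbT; apply/eqP => e.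
have nlt : (n < a n)%N by rewrite -(ltr_nat R) e; nra.
have k0 : (0 < a n - n)%N by lia.
apply: (complementary_neq _ _ _ _ _ _ hAB ha hb n0 k0).
have kb : (a n - n)%:R * beta = (a n)%:R.
  by rewrite natrB ?(ltnW nlt) // e {2}ab; ring.
apply/eqP; rewrite eqn_leq (beatty_geE _ _ _ _ _ Hb) // kb lexx /=.
by rewrite -ltnS (beatty_ltE _ _ _ _ _ Hb) // kb ltr_nat.
Qed.

(** The elements of [A] in the gap are the [a k] with [n < k <= b n - n]. *)
Lemma beatty_between_left (R : realType) (A B : set nat) (a b : nat -> nat)
    (alpha beta : R) (n : nat) :
  complementary A B -> enumerates a A -> enumerates b B ->
  beatty_seq alpha a -> beatty_seq beta b -> 1 < alpha -> alpha < 2 ->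
  (0 < n)%N -> (a n < b n)%N /\ between_seq A a b n = (b n - 2 * n)%N.
Proof.
move=> hAB ha hb Ha Hb alpha1 alpha2 n0.
have ab := beatty_complementary _ _ _ _ _ _ _ hAB ha hb Ha Hb alpha1.
have alpha1' := ltW alpha1.
have n0R : 0 < n%:R :> R by rewrite ltr0n.
(* By [ab], [(alpha - 1) (beta - 2) = 2 - alpha > 0]. *)
have beta2 : 2 < beta by nra.
have abn := complementary_neq _ _ _ _ _ _ hAB ha hb n0 n0.
have lt_ab : (a n < b n)%N.
  suff : (a n <= b n)%N by lia.
  rewrite (beatty_geE _ _ _ _ _ Hb) //.
  have : (a n)%:R <= n%:R * alpha by rewrite -(beatty_geE _ _ _ _ _ Ha).
  nra.
split=> //; rewrite /between_seq /count_between.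
have -> : minn (a n) (b n) = a n by lia.
have -> : maxn (a n) (b n) = b n by lia.
rewrite (count_image _ _ _ _ n (b n - n) ha.1); first by lia.
  by move=> k k'; apply: beatty_inj Ha _.
move=> k k0; congr (_ && _).
  case: (ltngtP n k) => nk.
  - by rewrite (beatty_ltn _ _ _ _ _ Ha).
  - by have := beatty_ltn _ _ _ _ _ Ha alpha1' k0 nk; lia.
  - by rewrite nk ltnn.
(* [a k < b n] iff [k alpha <= n beta] iff [k <= n (beta - 1)]. *)
have kbn := complementary_neq _ _ _ _ _ _ hAB ha hb k0 n0.
have bnle : (b n)%:R <= n%:R * beta by rewrite -(beatty_geE _ _ _ _ _ Hb).
have nb : (n <= b n)%N by rewrite (beatty_geE _ _ _ _ _ Hb) //; nra.
have -> : (k <= b n - n)%N = (k + n <= b n)%N by lia.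
rewrite (beatty_geE _ _ _ (k + n)%N _ Hb) // natrD.
apply/idP/idP => [|kn].
  rewrite (beatty_ltE _ _ _ _ _ Ha) // => kb.
  have : k%:R * alpha < n%:R * beta by apply: lt_le_trans kb bnle.
  rewrite {1}ab; nra.
suff : (a k <= b n)%N by lia.
rewrite (beatty_geE _ _ _ _ _ Hb) //.
have : (a k)%:R <= k%:R * alpha by rewrite -(beatty_geE _ _ _ _ _ Ha).
(* Multiply [k <= n (beta - 1)] by [alpha - 1], using [(alpha - 1) (beta - 1) = 1]. *)
have kn' : k%:R * (alpha - 1) <= n%:R by nra.
have : k%:R * alpha <= n%:R * beta by rewrite ab; nra.
by move=> h1 h2; apply: le_trans h2 h1.
Qed.

Theorem theorem1p2 (R : realType) (A B : set nat) (a b c r : nat -> nat)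
    (hAB : complementary A B) (ha : enumerates a A) (hb : enumerates b B)
    (hc : forall n : nat, (0 < n)%N -> c n = between_seq A a b n)
    (hr : forall n : nat, (0 < n)%N -> r n = between_seq B a b n) :
  (forall n : nat, (0 < n)%N ->
     `|(b n)%:Z - (a n)%:Z| = (c n)%:Z + (r n)%:Z + 1 /\
     ((a n < b n)%N -> (b n)%:Z - (a n)%:Z = (c n)%:Z + (r n)%:Z + 1)) /\
  (forall alpha beta : R,
     beatty_seq alpha a -> beatty_seq beta b -> 1 < alpha -> alpha < 2 ->
     let gamma := (2 - alpha) / (alpha - 1) in
     let rho := 2 - alpha in
     [/\ gamma = beta / alpha - 1,
         rho = 1 - alpha / beta,
         forall n : nat, (0 < n)%N ->
           (b n)%:Z - (a n)%:Z = (c n)%:Z + (r n)%:Z + 1,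
         beatty_seq gamma c
       & beatty_seq rho r]).
Proof.
have diff n : (0 < n)%N ->
    (maxn (a n) (b n) - minn (a n) (b n))%N = (c n + r n + 1)%N.
  by move=> n0; rewrite hc // hr // -complementary_diff.
split=> [n n0|alpha beta Ha Hb alpha1 alpha2 gamma rho].
  by have := diff n n0; split; lia.
have ab := beatty_complementary _ _ _ _ _ _ _ hAB ha hb Ha Hb alpha1.
have alpha10 : alpha - 1 != 0 by rewrite subr_eq0 gt_eqF.
have betaE : beta = alpha / (alpha - 1).
  by apply: (mulfI alpha10); rewrite -ab mulrC divfK.
have alpha0 : alpha != 0 by rewrite gt_eqF //; lra.
have cE n : (0 < n)%N -> (a n < b n)%N /\ c n = (b n - 2 * n)%N.
  by move=> n0; rewrite hc //; apply: beatty_between_left hAB ha hb Ha Hb _ _ _.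
(* Hence [n gamma] is [n beta] shifted by the integer [2 n], and its floor is [b n - 2 n]. *)
have gammaE : gamma = beta - 2 by rewrite /gamma betaE; field.
have beta2 : 2 < beta by nra.
(* Makes the truncated subtraction in [cE] exact. *)
have n2b n : (0 < n)%N -> (2 * n <= b n)%N.
  move=> n0; have : 0 < n%:R :> R by rewrite ltr0n.
  by rewrite (beatty_geE _ _ _ _ _ Hb) // natrM; nra.
split.
- by rewrite /gamma betaE; field; rewrite alpha10 alpha0.
- by rewrite /rho betaE; field; rewrite alpha10 alpha0.
- by move=> n n0; have := diff n n0; have [] := cE n n0; lia.
- split=> [|n n0]; first by rewrite gammaE subr_gt0.
  have cR : (c n)%:R = (b n)%:R - 2 * n%:R :> R.
    by have [_ ->] := cE n n0; rewrite natrB ?n2b // natrM.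
  apply/esym/floor_def; rewrite intrD -[_%:~R]/((c n)%:R) gammaE cR.
  have : (b n)%:R <= n%:R * beta by rewrite -(beatty_geE _ _ _ _ _ Hb).
  have : n%:R * beta < (b n)%:R + 1.
    by rewrite natr1 -(beatty_ltE _ _ _ _ _ Hb).
  by move=> *; apply/andP; split; lra.
- split=> [|n n0]; first by rewrite subr_gt0.
  (* Strictness here gives [n rho < 2 n - a n = r n + 1], the upper bound for the floor. *)
  have anlt := beatty_complementary_lt _ _ _ _ _ _ _ _ hAB ha hb Ha Hb alpha1 n0.
  have anle : n%:R * alpha < (a n)%:R + 1.
    by rewrite natr1 -(beatty_ltE _ _ _ _ _ Ha).
  have rE : (r n + a n + 1 = 2 * n)%N.
    by have := diff n n0; have [] := cE n n0; have := n2b n n0; lia.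
  have rR : (r n)%:R + (a n)%:R + 1 = 2 * n%:R :> R.
    by rewrite -natrD natr1 -addn1 rE natrM.
  apply/esym/floor_def; rewrite intrD -[_%:~R]/((r n)%:R) /rho.
  by apply/andP; split; lra.
Qed.
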